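(* Let $e_1,\dots,e_n$ and $e'_1,\dots,e'_n$ be two linearly independent systems of minimal vectors of a lattice in an $n$-dimensional Euclidean space $E$, satisfying a perfection relation $\sum_{i=1}^n\lambda_i\,p_{e_i}=\sum_{i=1}^n\lambda'_i\,p_{e'_i}$ with strictly positive real coefficients $\lambda_i,\lambda'_i$. Let $\Lambda_0$ be the lattice generated by the $e_i$ and $\Lambda$ the lattice generated by all the $e_i$ and $e'_i$, and assume $[\Lambda:\Lambda_0]=3$. Negating some $e_i$ and renumbering if necessary, write $\Lambda=\Lambda_0+\mathbb{Z}e$ with $e=\frac{e_1+\dots+e_\ell}3$ for some $\ell\le n$. Then $\ell=n=6$, and the relation is proportional to Watson's relation $\sum_{i=1}^6 p_{e_i}=\sum_{i=1}^6 p_{e-e_i}$.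
   Context: For a nonzero vector $x$ of a Euclidean space $E$, $p_x$ denotes the orthogonal projection of $E$ onto the line $\mathbb{R}x$ (a symmetric endomorphism of $E$). A minimal vector of a lattice is a nonzero lattice vector of minimal norm $x\cdot x$.
   Formalization: The perfection relation is taken to have no projection common to both sides (p_{e_i} ≠ p_{e'_j} for all i, j); otherwise adding the same term p_{e_7} to both sides of Watson's relation would give n = 7 and contradict the claim. *)

(* Defs.v *)
From HB Require Import structures.
From mathcomp Require Import all_boot all_order all_fingroup all_algebra.
From mathcomp Require Import reals.

Set Implicit Arguments.
Unset Strict Implicit.
Unset Printing Implicit Defensive.

Import Order.TTheory GRing.Theory Num.Theory.
Local Open Scope ring_scope.

Section Groups.

Variable V : zmodType.
Implicit Types A B : V -> Prop.

(* [A : B] = k, witnessed by k elements of A meeting each coset of B in A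
   exactly once; meaningful when B is a subgroup of A. *)
Definition has_index A B (k : nat) : Prop :=
  exists r : 'I_k -> V,
    (forall i, A (r i)) /\ (forall x, A x -> exists! i, B (x - r i)).

Definition add_cyclic B (e : V) : V -> Prop :=
  fun x => exists y (m : int), B y /\ x = y + e *~ m.

End Groups.

Section Euclidean.

Variables (R : realType) (E : vectType R) (dot : {dot E for idfun}).
Implicit Types L : E -> Prop.

Definition proj_line_fun (x y : E) : E := (dot y x / dot x x) *: x.

Fact proj_line_fun_linear x : linear (proj_line_fun x).
Proof.
move=> a y z; rewrite /proj_line_fun linearPl /= mulrDl scalerDl.
by rewrite scalerA mulrA.
Qed.

HB.instance Definition _ x :=
  GRing.isLinear.Build R E E *:%R (proj_line_fun x) (proj_line_fun_linear x).

Definition proj_line (x : E) : 'End(E) := linfun (proj_line_fun x).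

Lemma proj_lineE x y : proj_line x y = (dot y x / dot x x) *: x.
Proof. by rewrite lfunE. Qed.

Definition lattice L : Prop :=
  exists b : (\dim {:E}).-tuple E,
    basis_of {:E} b /\ (forall x, L x <-> inIntSpan b x).

Definition minimal_vector L (x : E) : Prop :=
  [/\ L x, x != 0 & forall y, L y -> y != 0 -> dot x x <= dot y y].

(* A perfection relation is a linear relation between the projections attached
   to the minimal vectors of L taken up to sign.  In the two-sided form below
   each p_x is collected on one side, so no projection occurs on both sides
   (for linearly independent x_i, the p_(x_i) are automatically distinct).
   Without this, adding the same term to both sides would change n. *)
Definition perfection_relation L m n (a : 'I_m -> R) (x : m.-tuple E)
    (b : 'I_n -> R) (y : n.-tuple E) : Prop :=
  [/\ forall i, minimal_vector L (tnth x i),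
      forall j, minimal_vector L (tnth y j),
      forall i j, proj_line (tnth x i) != proj_line (tnth y j)
    & \sum_i a i *: proj_line (tnth x i) = \sum_j b j *: proj_line (tnth y j)].

(* The relations \sum a_i p_(x_i) = \sum b_j p_(y_j) and
   \sum a'_i p_(x'_i) = \sum b'_j p_(y'_j) agree up to a nonzero factor and a
   reordering of the terms on each side. *)
Definition proportional_relations m n
    (a : 'I_m -> R) (x : m.-tuple E) (b : 'I_n -> R) (y : n.-tuple E)
    (a' : 'I_m -> R) (x' : m.-tuple E) (b' : 'I_n -> R) (y' : n.-tuple E)
    : Prop :=
  exists (c : R) (s : 'S_m) (t : 'S_n),
    [/\ c != 0,
        forall i, a i = c * a' (s i)
                  /\ proj_line (tnth x i) = proj_line (tnth x' (s i))
      & forall j, b j = c * b' (t j)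
                  /\ proj_line (tnth y j) = proj_line (tnth y' (t j))].

(* The vectors +- e_(s 0), ..., +- e_(s (n-1)), with sign given by eps. *)
Definition signed_renumbering n (e : n.-tuple E) (eps : 'I_n -> bool)
    (s : 'S_n) : n.-tuple E :=
  [tuple (-1) ^+ eps i *: tnth e (s i) | i < n].

(* (f_1 + ... + f_l) / 3 *)
Definition third_sum n (f : n.-tuple E) (l : nat) : E :=
  3^-1 *: \sum_(i < n | (i < l)%N) tnth f i.

End Euclidean.

(* Main.v *)
Require Import Defs.
From HB Require Import structures.
From mathcomp Require Import all_boot all_order all_fingroup all_algebra.
From mathcomp Require Import reals zify ring lra.

Set Implicit Arguments.
Unset Strict Implicit.
Unset Printing Implicit Defensive.

Import Order.TTheory GRing.Theory Num.Theory.
Local Open Scope ring_scope.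

(** Write c_i for the coordinates in the basis (e_i).  The relation says that
    sum_j lambda'_j c_i(e'_j) c_k(e'_j) = lambda_i delta_ik, so every quadratic
    form q satisfies sum_j lambda'_j q(e'_j) = sum_i lambda_i q(e_i), while
    comparing traces gives sum_j lambda'_j = sum_i lambda_i.  Watson's identity
    (l - 6) N(e) = sum_(i <= l) (N(e - e_i) - N(e_i)) and minimality of the e_i
    force l >= 6.  Now take
      q = 5 sum_i c_i^2 + (sum_(i <= l) c_i)^2 + sum_(i > l) c_i^2.
    It equals 6 on each e_i, and on the vectors of Lambda other than 0 and
    the +- e_i it is at least 6, with equality only at +- (e - e_i) when l = 6.
    Hence every e'_j is some +- (e - e_i), so n = l = 6, and the second moments
    then force all the coefficients to be equal. *)

(** * Subgroups and quotients of order three *)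

Section Subgroups.

Variable V : zmodType.
Implicit Types A B : V -> Prop.

Definition subgroup A := A 0 /\ forall x y, A x -> A y -> A (x - y).

Lemma subgroupN A x : subgroup A -> A x -> A (- x).
Proof. by case=> A0 AB Ax; rewrite -sub0r; apply: AB. Qed.

Lemma subgroupD A x y : subgroup A -> A x -> A y -> A (x + y).
Proof.
by move=> sA Ax Ay; rewrite -[y]opprK; apply: (proj2 sA) => //; apply: subgroupN.
Qed.

Lemma subgroupMz A x (m : int) : subgroup A -> A x -> A (x *~ m).
Proof.
move=> sA Ax; have AxMn k : A (x *+ k).
  by elim: k => [|k IHk]; [exact: (proj1 sA) | rewrite mulrS; apply: subgroupD].
by case: m => k; [exact: AxMn | exact: subgroupN (AxMn _)].
Qed.

Lemma inIntSpan_subgroup m (s : m.-tuple V) : subgroup (inIntSpan s).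
Proof.
split=> [|x y [a ->] [b ->]].
  by exists [ffun=> 0]; rewrite big1 // => i _; rewrite ffunE mulr0z.
exists [ffun i => a i - b i]; rewrite -sumrB.
by apply: eq_bigr => i _; rewrite ffunE mulrzBr.
Qed.

Lemma mem_inIntSpan m (s : m.-tuple V) x : x \in s -> inIntSpan s x.
Proof.
case/tnthP=> i ->; exists [ffun j => (j == i)%:Z].
rewrite (bigD1 i) //= big1 ?ffunE ?eqxx ?addr0 -?tnth_nth // => j /negPf ji.
by rewrite ffunE ji mulr0z.
Qed.

Lemma inIntSpan_min A m (s : m.-tuple V) :
  subgroup A -> (forall x, x \in s -> A x) -> forall x, inIntSpan s x -> A x.
Proof.
move=> sA As x [a ->]; apply: big_ind => [|y z|i _]; first exact: (proj1 sA).
  exact: subgroupD.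
by apply: subgroupMz => //; apply: As; rewrite -tnth_nth mem_tnth.
Qed.

Section IndexThree.

Variables A B : V -> Prop.
Hypotheses (sA : subgroup A) (sB : subgroup B) (index3 : has_index A B 3).

Lemma index3_pigeonhole x y z w : A x -> A y -> A z -> A w ->
  ~ B (x - y) -> ~ B (x - z) -> ~ B (y - z) ->
  [\/ B (w - x), B (w - y) | B (w - z)].
Proof.
have [r [rA rU]] := index3.
move=> /rU[i [xi _]] /rU[j [yj _]] /rU[k [zk _]] /rU[h [wh _]].
have same u v a : B (u - r a) -> B (v - r a) -> B (u - v).
  by move=> ua va; have := proj2 sB _ _ ua va; rewrite opprB addrA subrK.
move=> nxy nxz nyz.
have ij : i != j by apply/eqP => ij; apply: nxy; apply: same xi _; rewrite ij.
have ik : i != k by apply/eqP => ik; apply: nxz; apply: same xi _; rewrite ik.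
have jk : j != k by apply/eqP => jk; apply: nyz; apply: same yj _; rewrite jk.
have : [|| h == i, h == j | h == k].
  move: ij ik jk; rewrite -!val_eqE /=.
  by move: (ltn_ord i) (ltn_ord j) (ltn_ord k) (ltn_ord h); lia.
by case/or3P=> /eqP hE; [apply: Or31 | apply: Or32 | apply: Or33];
  apply: same wh _; rewrite hE.
Qed.

(** The class of a difference [v] of two representatives has order 3: if [v + v] were in [B], then
    [0], [v], [w] and [w + v] would give four distinct classes. So [0], [v] and [- v] represent all
    classes, and [v + v] can only be congruent to [- v]. *)
Lemma index3_generator : (forall x, B x -> A x) ->
  exists v, [/\ A v, ~ B v, B (v *+ 3) & forall x, A x <-> add_cyclic B v x].
Proof.
move=> sBA; have [r [rA rU]] := index3.
have rB i j : i != j -> ~ B (r i - r j).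
  move=> /eqP ij Bij; apply: ij; have [k [_ kU]] := rU _ (rA i).
  by rewrite -(kU _ Bij); apply/esym/kU; rewrite subrr; case: sB.
have Ar i j : A (r i - r j) by apply: (proj2 sA).
set o1 : 'I_3 := inord 1; set o2 : 'I_3 := inord 2.
have neq01 : ord0 != o1 by rewrite -val_eqE /= inordK.
have neq02 : ord0 != o2 by rewrite -val_eqE /= inordK.
have neq12 : o1 != o2 by rewrite -val_eqE /= !inordK.
pose v := r ord0 - r o1; pose w := r o2 - r o1.
have Av : A v by apply: Ar.
have Aw : A w by apply: Ar.
have nBv : ~ B v by apply: rB.
have nBw : ~ B w by apply: rB; rewrite eq_sym.
have nBwv : ~ B (w - v).
  by rewrite /w /v opprB addrA subrK; apply: rB; rewrite eq_sym.
have nB0 x : ~ B x -> ~ B (0 - x).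
  by move=> nBx; rewrite sub0r => /(subgroupN sB); rewrite opprK.
have A0 := proj1 sA.
have nB2v : ~ B (v + v).
  move=> B2v.
  have nBvw : ~ B (v - w) by move/(subgroupN sB); rewrite opprB.
  have := index3_pigeonhole A0 Av Aw (subgroupD sA Aw Av)
    (nB0 _ nBv) (nB0 _ nBw) nBvw.
  case; [rewrite subr0 => Bwv|by rewrite addrK|by rewrite addrAC subrr add0r].
  by apply: nBwv; have := proj2 sB _ _ Bwv B2v; rewrite opprD addrA addrK.
have cosets x : A x -> [\/ B x, B (x - v) | B (x + v)].
  move=> Ax; have := @index3_pigeonhole 0 v (- v) x A0 Av (subgroupN sA Av) Ax.
  rewrite subr0 !opprK; apply; [exact: nB0 | by rewrite add0r | exact: nB2v].
have B3v : B (v *+ 3).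
  case: (cosets _ (subgroupD sA Av Av)) => //; first by rewrite addrK.
  by rewrite !mulrSr mulr0n add0r.
exists v; split=> // x; split=> [/cosets[Bx|Bx|Bx] | [y [m [By ->]]]].
- by exists x, 0; rewrite mulr0z addr0.
- by exists (x - v), 1; rewrite mulr1z subrK.
- by exists (x + v), (-1); rewrite mulrNz mulr1z addrK.
- by apply: subgroupD => //; [apply: sBA | apply: subgroupMz].
Qed.

(** Otherwise every representative would be congruent to [0], against uniqueness. This later rules
    out [l = 0]. *)
Lemma index3_not_sub : ~ (forall x, A x -> B x).
Proof.
move=> sAB; have [r [rA rU]] := index3.
have [k [_ kU]] := rU _ (proj1 sA).
have kE i : k = i by apply: kU; apply: (proj2 sB) (proj1 sB) (sAB _ (rA i)).
by have := kE ord_max; rewrite (kE ord0).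
Qed.

End IndexThree.

End Subgroups.

(* The expression is 9 times the value of [qform] below on e + z, where
   Z, N and M are the sum of the first l coordinates of z, the sum of their
   squares, and the sum of the squares of the other coordinates. *)
Lemma ge54_eq54 (l Z N M : int) : 6 <= l -> Z <= N -> - Z <= N -> 0 <= M ->
  let Q := 5 * l + 30 * Z + 45 * N + (l + 3 * Z) ^+ 2 + 54 * M in
  54 <= Q /\ (Q = 54 -> [/\ l = 6, N = 1, Z = -1 & M = 0]).
Proof.
move=> l6 ZN NZ M0 Q.
have QE : Q = 5 * l + 30 * Z + 45 * N + (l + 3 * Z) * (l + 3 * Z) + 54 * M by [].
(* For [Z >= 0] the square is at least 36, on top of [5 * l >= 30]. For [Z <= -3], [N >= - Z] gives
   [30 * Z + 45 * N >= 45]. For [Z = -2] the total is at least 60, so 54 is reached only at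
   [Z = -1]. *)
have [Z0|Z0] := leP 0 Z.
  have : 36 <= (l + 3 * Z) * (l + 3 * Z) by nia.
  lia.
have [Z3|Z3] := leP Z (-3).
  have : 0 <= (l + 3 * Z) * (l + 3 * Z) by nia.
  lia.
have [Z1|Z1] : Z = -1 \/ Z = -2 by lia.
  rewrite Z1 in QE *.
  split; first by nia.
  move=> Q54; have l6' : l = 6 by nia.
  by subst l; split=> //; lia.
rewrite Z1 in QE *.
have : 0 <= (l + 3 * -2) * (l + 3 * -2) by nia.
lia.
Qed.

(** * Coordinates, projections and moments of a perfection relation *)

Section Coordinates.

Variables (R : realType) (E : vectType R) (dot : {dot E for idfun}).
Implicit Types (x y : E) (p : nat).

Lemma dotC x y : dot x y = dot y x.
Proof. by rewrite hermC expr0 mul1r. Qed.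

Lemma dot_inj x y : (forall z, dot z x = dot z y) -> x = y.
Proof.
move=> xy; apply/eqP; rewrite -subr_eq0; apply/idPn => /(@neq0_dnorm_gt0 _ _ _ dot).
by rewrite linearBr /= xy subrr ltxx.
Qed.

Lemma proj_line_sign (b : bool) x : proj_line dot ((-1) ^+ b *: x) = proj_line dot x.
Proof.
case: b; last by rewrite expr0 scale1r.
apply/lfunP => y; rewrite expr1 scaleN1r !proj_lineE hnormN linearNr.
by rewrite mulNr scalerN scaleNr opprK.
Qed.

Lemma coord_third_sum p (f : p.-tuple E) l i : free f ->
  coord f i (third_sum f l) = 3^-1 * (i < l)%N%:R.
Proof.
move=> free_f; rewrite /third_sum linearZ linear_sum /=; congr (_ * _).
have cE j : coord f i (tnth f j) = (j == i)%:R by rewrite (tnth_nth 0) coord_free.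
have [il|il] := boolP (i < l)%N.
  rewrite (bigD1 i) //= cE eqxx big1 ?addr0 // => j /andP[_ /negPf ji].
  by rewrite cE ji.
rewrite big1 // => j jl; rewrite cE; case: eqP => // ji.
by rewrite -ji jl in il.
Qed.

Lemma coord_inIntSpan p (f : p.-tuple E) x : free f -> inIntSpan f x ->
  exists z : 'I_p -> int, forall i, coord f i x = (z i)%:~R.
Proof.
move=> free_f [a ->]; exists a => i; rewrite linear_sum (bigD1 i) //= big1.
  by rewrite raddfMz /= coord_free // eqxx addr0.
by move=> j /negPf ji; rewrite raddfMz /= coord_free // ji mul0rz.
Qed.

Section SecondMoments.

Variables (p q : nat) (f : p.-tuple E) (g : q.-tuple E).
Variables (mu : 'I_p -> R) (la : 'I_q -> R) (N : R).
Hypotheses (free_f : free f) (N_neq0 : N != 0).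
Hypotheses (norm_f : forall i, dot (tnth f i) (tnth f i) = N).
Hypotheses (norm_g : forall j, dot (tnth g j) (tnth g j) = N).
Hypothesis rel : \sum_i mu i *: proj_line dot (tnth f i)
               = \sum_j la j *: proj_line dot (tnth g j).

Lemma coord_tnth i k : coord f i (tnth f k) = (i == k)%:R.
Proof. by rewrite (tnth_nth 0) coord_free // eq_sym. Qed.

(** Evaluating the relation at [y] and reading the [i]-th coordinate leaves one term on the left, a
    multiple of [dot y (tnth f i)]; nondegeneracy of [dot] then removes [y]. *)
Lemma relation_vector i :
  mu i *: tnth f i = \sum_j (la j * coord f i (tnth g j)) *: tnth g j.
Proof.
apply: dot_inj => y; have := congr1 (fun h : 'End(E) => coord f i (h y)) rel.
rewrite !sum_lfunE !linear_sum (bigD1 i) //= big1 => [|k /negPf ki].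
  rewrite scale_lfunE proj_lineE norm_f !linearZ_LR /= coord_tnth eqxx mulr1 addr0.
  move/(congr1 ( *%R^~ N)); rewrite -mulrA divfK // => ->.
  rewrite mulr_suml; apply: eq_bigr => j _.
  by rewrite scale_lfunE proj_lineE norm_g !linearZ_LR /=; field.
by rewrite scale_lfunE proj_lineE !linearZ_LR /= coord_tnth eq_sym ki !mulr0.
Qed.

(** This is the [k]-th coordinate of [relation_vector]. It turns the relation between projections
    into weighted sums of quadratic forms over the [g_j]. *)
Lemma relation_second_moments i k :
  \sum_j la j * (coord f i (tnth g j) * coord f k (tnth g j)) = mu i * (i == k)%:R.
Proof.
have := congr1 (coord f k) (relation_vector i).
rewrite linearZ_LR /= coord_tnth eq_sym linear_sum => ->.
by apply: eq_bigr => j _; rewrite linearZ_LR /= mulrA.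
Qed.

(* Each p_x has trace 1. *)
Lemma relation_trace : basis_of fullv f -> \sum_i mu i = \sum_j la j.
Proof.
move=> basis_f; apply: (mulIf N_neq0); rewrite !mulr_suml.
(* Pair [relation_vector] with [f_i]; summing over [i] then reassembles [g_j] from its
   coordinates. *)
have muN i : mu i * N = \sum_j la j * coord f i (tnth g j) * dot (tnth g j) (tnth f i).
  rewrite -(norm_f i) -[LHS](linearZl_LR dot) relation_vector linear_sumlz.
  by apply: eq_bigr => j _; rewrite linearZl_LR.
rewrite (eq_bigr _ (fun i _ => muN i)) exchange_big /=; apply: eq_bigr => j _.
rewrite -(norm_g j) [X in _ = _ * dot _ X](coord_basis basis_f (memvf (tnth g j))).
rewrite linear_sumr mulr_sumr.
by apply: eq_bigr => i _; rewrite linearZr_LR /= -tnth_nth mulrA.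
Qed.

End SecondMoments.

End Coordinates.

(** * Watson's identity and short integer vectors *)

Lemma sumr_const_ord (V : nmodType) (n l : nat) (x : V) : (l <= n)%N ->
  \sum_(i < n | (i < l)%N) x = x *+ l.
Proof.
by move=> ln; rewrite -(big_ord_widen n (fun=> x) ln) sumr_const card_ord.
Qed.

(** Each summand is [N(e) - 2 (e . f_i)] and the first [l] vectors sum to [3 e], whence the factor
    [l - 2 * 3]. When the [f_i] are minimal, the left side is nonnegative, which will give
    [l >= 6]. *)
Lemma watson_identity (R : realType) (E : vectType R) (dot : {dot E for idfun})
    (n l : nat) (f : n.-tuple E) (N : R) (e := third_sum f l) : (l <= n)%N ->
    (forall i, dot (tnth f i) (tnth f i) = N) ->
  \sum_(i < n | (i < l)%N) (dot (e - tnth f i) (e - tnth f i) - N)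
  = (l%:R - 6) * dot e e.
Proof.
move=> ln norm_f.
have e3 : \sum_(i < n | (i < l)%N) tnth f i = 3 *: e.
  by rewrite scalerA divff ?scale1r // pnatr_eq0.
clearbody e.
have expand i : dot (e - tnth f i) (e - tnth f i) - N
                = dot e e - 2 * dot e (tnth f i).
  by rewrite -(norm_f i) linearBl /= !linearBr /= (dotC dot (tnth f i) e); ring.
rewrite (eq_bigr _ (fun i _ => expand i)).
rewrite sumrB sumr_const_ord // -mulr_sumr -linear_sumr e3 linearZr_LR /=.
by rewrite -mulr_natl; ring.
Qed.

Lemma sum_sqr_le1 (n : nat) (P : pred 'I_n) (z : 'I_n -> int) :
    \sum_(i < n | P i) z i ^+ 2 <= 1 ->
  (forall i, P i -> z i = 0) \/
  exists i, [/\ P i, z i ^+ 2 = 1 & forall j, P j -> j != i -> z j = 0].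
Proof.
move=> z1; case: (pickP (fun i => P i && (z i != 0))) => [i /andP[Pi zi]|z0]; last first.
  by left=> i Pi; have /negbT := z0 i; rewrite Pi /= negbK => /eqP.
right; exists i; move: z1; rewrite (bigD1 i) //=.
set s := (X in _ + X <= 1) => z1.
have s0 : 0 <= s by apply: sumr_ge0 => j _; rewrite sqr_ge0.
have zi1 : 1 <= z i ^+ 2 by nia.
split=> //; first by lia.
have s_eq0 : s = 0 by lia.
move=> j Pj ji; apply/eqP; rewrite -sqrf_eq0; apply/eqP.
by apply: (psumr_eq0P _ s_eq0) => [k _|]; rewrite ?sqr_ge0 ?Pj.
Qed.

(** * The quadratic form: its weighted sums and its values on lattice cosets *)

Section QuadraticForm.

Variables (R : realFieldType) (n l : nat).
Implicit Types (c : 'I_n -> R) (z : 'I_n -> int).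

(* The form equals 6 on the basis vectors and, when l = 6, on the vectors
   e - e_i, and it is larger on every other candidate for an e'_j. *)
Definition qform c : R :=
  5 * \sum_i c i ^+ 2 + (\sum_(i < n | (i < l)%N) c i) ^+ 2
  + \sum_(i < n | ~~ (i < l)%N) c i ^+ 2.

Lemma eq_qform c d : c =1 d -> qform c = qform d.
Proof.
move=> cd; rewrite /qform; congr (5 * _ + _ ^+ 2 + _);
by apply: eq_bigr => i _; rewrite cd.
Qed.

Lemma qformN c : qform (fun i => - c i) = qform c.
Proof.
rewrite /qform sumrN sqrrN; congr (5 * _ + _ + _);
by apply: eq_bigr => i _; rewrite sqrrN.
Qed.

(** Mixed moments vanish, so only the diagonal entries of the form count. Each equals [5 + 1], the 1
    coming from the squared sum when [i < l] and from the last sum otherwise. *)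
Lemma qform_moments q (la : 'I_q -> R) (mu : 'I_n -> R) (C : 'I_q -> 'I_n -> R) :
    (forall i k, \sum_j la j * (C j i * C j k) = mu i * (i == k)%:R) ->
  \sum_j la j * qform (C j) = 6 * \sum_i mu i.
Proof.
move=> moments.
have diag (P : pred 'I_n) : \sum_j la j * (\sum_(i < n | P i) C j i ^+ 2)
                          = \sum_(i < n | P i) mu i.
  under eq_bigr do rewrite mulr_sumr.
  rewrite exchange_big; apply: eq_bigr => i _.
  by under eq_bigr do rewrite expr2; rewrite moments eqxx mulr1.
have square : \sum_j la j * (\sum_(i < n | (i < l)%N) C j i) ^+ 2
            = \sum_(i < n | (i < l)%N) mu i.
  under eq_bigr => j _.
    rewrite expr2 mulr_suml mulr_sumr.
    under eq_bigr do rewrite mulr_sumr mulr_sumr.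
    over.
  rewrite exchange_big; apply: eq_bigr => i il.
  rewrite exchange_big (bigD1 i) //= moments eqxx mulr1 big1 ?addr0 // => k.
  by case/andP=> _ /negPf ki; rewrite moments eq_sym ki mulr0.
have -> : \sum_j la j * qform (C j) =
    5 * (\sum_j la j * (\sum_i C j i ^+ 2))
    + \sum_j la j * (\sum_(i < n | (i < l)%N) C j i) ^+ 2
    + \sum_j la j * (\sum_(i < n | ~~ (i < l)%N) C j i ^+ 2).
  rewrite mulr_sumr -!big_split; apply: eq_bigr => j _ /=; rewrite /qform; ring.
by rewrite square !diag [\sum_i mu i](bigID (fun i : 'I_n => (i < l)%N)) /=; ring.
Qed.

(** The squares of the [z i] sum to at least 2 here, so the first term of the form alone is at least
    10. *)
Lemma qform_int_gt6 z : (exists i, z i != 0) ->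
    (forall i, ~ (z i ^+ 2 = 1 /\ forall j, j != i -> z j = 0)) ->
  6 < qform (fun i => (z i)%:~R).
Proof.
move=> [i zi] nz; rewrite ltNge; apply/negP => q6.
have : \sum_i z i ^+ 2 <= 1.
  suff : 5 * (\sum_i z i ^+ 2)%:~R <= 6 :> R.
    rewrite -[5]/(5%:~R) -[6]/(6%:~R) -intrM ler_int; lia.
  apply: le_trans q6; rewrite /qform rmorph_sum /=.
  under eq_bigr do rewrite rmorphXn.
  rewrite -addrA lerDl addr_ge0 ?sqr_ge0 //.
  by apply: sumr_ge0 => j _; rewrite sqr_ge0.
case/sum_sqr_le1 => [z0|[k [_ zk z0]]]; first by rewrite z0 ?eqxx in zi.
by apply: (nz k); split=> // j; apply: z0.
Qed.

(** Multiplying by 9 clears denominators and reduces the bound to [ge54_eq54]. Its equality case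
    [N = 1], [Z = -1], [M = 0] leaves one nonzero [z i], equal to -1 with [i < l]: the point is
    [e - e_i]. *)
Lemma qform_third_ge6 z (Q := qform (fun i => 3^-1 * (i < l)%N%:R + (z i)%:~R)) :
    (6 <= l <= n)%N ->
  6 <= Q /\ (Q = 6 -> l = 6%N /\ exists2 i : 'I_n, (i < l)%N &
                                  forall j, z j = - (j == i)%:Z).
Proof.
case/andP=> l6 ln.
pose Z := \sum_(i < n | (i < l)%N) z i.
pose N := \sum_(i < n | (i < l)%N) z i ^+ 2.
pose M := \sum_(i < n | ~~ (i < l)%N) z i ^+ 2.
(* Integers satisfy [|x| <= x ^+ 2], hence [|Z| <= N]. *)
have absN x : x <= x ^+ 2 /\ - x <= x ^+ 2 :> int by split; nia.
have ZN : Z <= N by apply: ler_sum => i _; case: (absN (z i)).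
have NZ : - Z <= N by rewrite -sumrN; apply: ler_sum => i _; case: (absN (z i)).
have M0 : 0 <= M by apply: sumr_ge0 => i _; rewrite sqr_ge0.
have [] := @ge54_eq54 l%:Z Z N M _ ZN NZ M0; first by lia.
set K := (5 * _ + _ + _ + _ + _) => K54 K54E.
have QE : 9 * Q = K%:~R.
  have sum1 : \sum_(i < n | (i < l)%N) (3^-1 * (i < l)%N%:R + (z i)%:~R)
            = 3^-1 * l%:R + Z%:~R :> R.
    rewrite big_split /=; congr (_ + _); last by rewrite rmorph_sum.
    under eq_bigr => i il do rewrite il.
    by rewrite sumr_const_ord // mulr1 mulr_natr.
  have sum2 : \sum_(i < n | (i < l)%N) (3^-1 * (i < l)%N%:R + (z i)%:~R) ^+ 2
            = 9^-1 * l%:R + 2 * 3^-1 * Z%:~R + N%:~R :> R.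
    transitivity (\sum_(i < n | (i < l)%N)
                    (9^-1 + 2 * 3^-1 * (z i)%:~R + (z i ^+ 2)%:~R : R)).
      by apply: eq_bigr => i ->; rewrite rmorphXn /=; field.
    rewrite !big_split /= sumr_const_ord // -[_ *+ l]mulr_natr -mulr_sumr.
    by rewrite /Z /N !rmorph_sum.
  have sum3 : \sum_(i < n | ~~ (i < l)%N) (3^-1 * (i < l)%N%:R + (z i)%:~R) ^+ 2
            = M%:~R :> R.
    rewrite rmorph_sum; apply: eq_bigr => i /negPf ->.
    by rewrite mulr0 add0r rmorphXn.
  rewrite /Q /qform (bigID (fun i : 'I_n => (i < l)%N)) /= sum1 sum2 sum3.
  by rewrite /K !(rmorphD, rmorphM, rmorphXn) /= -pmulrn; field.
have K54R : 54 <= K%:~R :> R by rewrite -[54]/(54%:~R) ler_int.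
split=> [|Q6]; first by lra.
have : K = 54 by apply/eqP; rewrite -(eqr_int R) -QE Q6; apply/eqP; ring.
case/K54E => l6' N1 Z1 Meq0.
have /sum_sqr_le1[z0|[i [il zi z0]]] : N <= 1 by rewrite N1.
  by have := Z1; rewrite /Z big1.
split; first by lia.
exists i => // j; case: eqP => [->|/eqP ji].
  have := Z1; rewrite /Z (bigD1 i) //= big1 ?addr0 // => k /andP[]; exact: z0.
have [jl|jl] := boolP (j < l)%N; first by rewrite z0.
apply/eqP; rewrite oppr0 -sqrf_eq0.
by apply/eqP; apply: (psumr_eq0P _ Meq0) => // k _; rewrite sqr_ge0.
Qed.

End QuadraticForm.

(** * Cosets modulo the sublattice and the bound on lattice vectors *)

Lemma centered_mod3 (m : int) :
  exists q r : int, [/\ m = 3 * q + r, -1 <= r & r <= 1].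
Proof.
exists (divz (m + 1) 3), (modz (m + 1) 3 - 1).
have := divz_eq (m + 1) 3; have := @modz_ge0 (m + 1) 3 isT.
by have := @ltz_pmod (m + 1) 3 isT; split; lia.
Qed.

(** Multiples of [3 e] are absorbed by the integral part, so only the remainders -1, 0 and 1 are
    left, and a sign exchanges the two nontrivial cosets. *)
Lemma coord_coset (R : realType) (E : vectType R) n l (f : n.-tuple E) x :
    free f -> add_cyclic (inIntSpan f) (third_sum f l) x ->
  exists z : 'I_n -> int, (forall i, coord f i x = (z i)%:~R) \/
  exists b : bool, forall i,
    coord f i ((-1) ^+ b *: x) = 3^-1 * (i < l)%N%:R + (z i)%:~R.
Proof.
move=> free_f [y [m [/(coord_inIntSpan free_f)[a ya] ->]]].
have [q [r [-> r1 r2]]] := centered_mod3 m.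
have c i : coord f i (y + third_sum f l *~ (3 * q + r)) =
    (a i + q * (i < l)%N%:Z)%:~R + r%:~R * (3^-1 * (i < l)%N%:R).
  rewrite linearD raddfMz /= ya coord_third_sum // -mulrzr !intrD !intrM -pmulrn.
  by case: (i < l)%N => /=; field.
have [r0|[r1'|rN1]] : r = 0 \/ r = 1 \/ r = -1 by lia.
- by exists (fun i => a i + q * (i < l)%N%:Z); left=> i; rewrite c r0 mul0r addr0.
- exists (fun i => a i + q * (i < l)%N%:Z); right; exists false => i.
  by rewrite expr0 scale1r c r1' mul1r addrC.
- exists (fun i => - (a i + q * (i < l)%N%:Z)); right; exists true => i.
  by rewrite expr1 scaleN1r linearN /= c rN1 mulN1r mulrNz opprD opprK addrC.
Qed.

Lemma coord_basis_inj (K : fieldType) (E : vectType K) n (f : n.-tuple E) x y :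
  basis_of fullv f -> (forall i, coord f i x = coord f i y) -> x = y.
Proof.
move=> bf xy; rewrite (coord_basis bf (memvf x)) (coord_basis bf (memvf y)).
by apply: eq_bigr => i _; rewrite xy.
Qed.

(** In the trivial coset, the hypothesis on projections excludes the vectors [+- f_i], which leaves
    [6 < Q]. In the other two, evenness of the form reduces to [qform_third_ge6]. *)
Lemma qform_minimal (R : realType) (E : vectType R) (dot : {dot E for idfun})
    n l (f : n.-tuple E) x (Q := qform l (fun i => coord f i x)) :
    basis_of fullv f -> (6 <= l <= n)%N -> x != 0 ->
    add_cyclic (inIntSpan f) (third_sum f l) x ->
    (forall i, proj_line dot (tnth f i) != proj_line dot x) ->
  6 <= Q /\ (Q = 6 -> l = 6%N /\ exists i : 'I_n, (i < l)%N /\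
     exists b : bool, x = (-1) ^+ b *: (third_sum f l - tnth f i)).
Proof.
move=> bf ln x0 xL px; have ff := basis_free bf.
have cf k i : coord f i (tnth f k) = (i == k)%:R by rewrite coord_tnth.
have [z [cz|[b cz]]] := coord_coset ff xL.
  suff : 6 < Q by move=> Q6; split; [exact: ltW | move=> QE; rewrite QE ltxx in Q6].
  rewrite /Q (eq_qform _ cz); apply: qform_int_gt6.
    case: (pickP (fun i => z i != 0)) => [i zi|z0]; first by exists i.
    case/eqP: x0; apply: (coord_basis_inj bf) => i.
    by rewrite cz linear0; have /negbT := z0 i; rewrite negbK => /eqP ->.
  move=> i [/eqP]; rewrite sqrf_eq1 => zi z0.
  case/eqP: (px i); suff -> : x = (-1) ^+ (z i == -1) *: tnth f i.
    by rewrite proj_line_sign.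
  apply: (coord_basis_inj bf) => k; rewrite cz linearZ_LR /= cf.
  have [->|ki] := eqVneq k i; last by rewrite z0 ?mulr0.
  by case/orP: zi => /eqP ->; rewrite ?expr0 ?expr1 mulr1.
have QE : Q = qform l (fun i => 3^-1 * (i < l)%N%:R + (z i)%:~R).
  rewrite -(eq_qform _ cz); case: b {cz} => /=.
    rewrite -qformN /Q; apply: eq_qform => i.
    by rewrite expr1 scaleN1r linearN opprK.
  by apply: eq_qform => i; rewrite expr0 scale1r.
rewrite QE; have [Q6 eqQ] := qform_third_ge6 R z ln; split=> // /eqQ[l6 [i il zE]].
split=> //; exists i; split=> //; exists b.
suff <- : (-1) ^+ b *: x = third_sum f l - tnth f i.
  by rewrite scalerA -signr_addb addbb scale1r.
apply: (coord_basis_inj bf) => k; rewrite cz zE linearB /= coord_third_sum // cf.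
by rewrite mulrNz.
Qed.

(** * The equality case: equal coefficients and Watson's relation *)

Lemma watson_coefficients (R : realFieldType) n (mu la : 'I_n -> R) : n = 6%N ->
    (forall i k, \sum_j la j * ((3^-1 - (i == j)%:R) * (3^-1 - (k == j)%:R))
                 = mu i * (i == k)%:R) ->
  exists a, forall i, mu i = a /\ la i = a.
Proof.
move=> n6 moments; pose S := \sum_j la j.
have delta i (x : 'I_n -> R) : \sum_j x j * (i == j)%:R = x i.
  rewrite (bigD1 i) //= eqxx mulr1 big1 ?addr0 // => j.
  by rewrite eq_sym => /negPf ->; rewrite mulr0.
have expand i k : mu i * (i == k)%:R
    = 9^-1 * S - 3^-1 * la i - 3^-1 * la k + la i * (i == k)%:R.
  have <- : \sum_j (la j * (i == j)%:R) * (k == j)%:R = la i * (i == k)%:R.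
    rewrite (delta k (fun j => la j * (i == j)%:R)).
    by case: eqP => [->|] //=; rewrite !mulr0.
  rewrite -moments -(delta i la) -(delta k la) !mulr_sumr -!sumrB -big_split.
  by apply: eq_bigr => j _ /=; field.
(* Off the diagonal [expand] says [la i + la k = S / 3]. Compare the pairs [(m, i)] and [(m, k)] for
   an index [m] different from both, which exists since [n = 6]. *)
have la_eq i k : la i = la k.
  have : (0 < #|~: [set i; k]|)%N by rewrite cardsCs setCK cards2 card_ord; lia.
  case/card_gt0P=> m; rewrite !inE negb_or => /andP[/negPf mi /negPf mk].
  have := expand m i; have := expand m k; rewrite mi mk !mulr0; lra.
have i0 : 'I_n by rewrite n6; apply: ord0.
exists (la i0) => i; split; last exact: la_eq.
(* With [a] the common value, the diagonal case of [expand] gives [mu i = 6a/9 - 2a/3 + a = a]. *)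
have S6 : S = 6 * la i0.
  rewrite /S (eq_bigr (fun=> la i0)) => [|j _]; last exact: la_eq.
  by rewrite sumr_const card_ord n6 mulr_natl.
have := expand i i; rewrite eqxx S6 (la_eq i i0) !mulr1; lra.
Qed.

(** By the moments and the trace, the weighted mean of [qform] over the [g_j] is exactly 6, while
    each value is at least 6. Positive weights force equality, so each [g_j] is some
    [+- (e - f_(t j))], and freeness of [g] makes [t] injective. *)
Lemma watson_relation (R : realType) (E : vectType R) (dot : {dot E for idfun})
    n l (f g : n.-tuple E) (mu la : 'I_n -> R) (N : R) (e := third_sum f l) :
    basis_of fullv f -> free g -> 0 < N ->
    (forall i, dot (tnth f i) (tnth f i) = N) ->
    (forall j, dot (tnth g j) (tnth g j) = N) ->
    (forall j, 0 < la j) ->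
    (forall j, add_cyclic (inIntSpan f) e (tnth g j)) ->
    (forall i j, proj_line dot (tnth f i) != proj_line dot (tnth g j)) ->
    \sum_i mu i *: proj_line dot (tnth f i)
      = \sum_j la j *: proj_line dot (tnth g j) ->
    (6 <= l <= n)%N ->
  [/\ l = n, n = 6%N & exists (a : R) (t : 'S_n),
    [/\ a != 0, forall i, mu i = a
      & forall j, la j = a /\
          proj_line dot (tnth g j) = proj_line dot (e - tnth f (t j))]].
Proof.
move=> bf free_g N0 nf ng la0 gL px rel ln; have ff := basis_free bf.
have N_neq0 := lt0r_neq0 N0.
have moments := relation_second_moments ff N_neq0 nf ng rel.
have trace := relation_trace ff N_neq0 nf ng rel bf.
have g0 j : tnth g j != 0.
  by apply: contraTneq N0 => gj; rewrite -(ng j) gj linear0l ltxx.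
have Qmin j := qform_minimal bf ln (g0 j) (gL j) (fun i => px i j).
have Q6 j : qform l (fun i => coord f i (tnth g j)) = 6.
  have : \sum_j la j * (qform l (fun i => coord f i (tnth g j)) - 6) = 0.
    under eq_bigr do rewrite mulrBr.
    rewrite sumrB (qform_moments l moments) trace mulr_sumr -sumrB.
    by rewrite big1 // => k _; ring.
  move=> sum0; have ge0 k : 0 <= la k * (qform l (fun i => coord f i (tnth g k)) - 6).
    by rewrite mulr_ge0 ?(ltW (la0 k)) // subr_ge0; case: (Qmin k).
  have /eqP := psumr_eq0P (fun k _ => ge0 k) sum0 (i := j) isT.
  by rewrite mulf_eq0 (negPf (lt0r_neq0 (la0 j))) subr_eq0 => /eqP.
have /fin_all_exists[t] j : exists i : 'I_n, (i < l)%N /\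
    exists b : bool, tnth g j = (-1) ^+ b *: (e - tnth f i).
  by case: (Qmin j) => _ /(_ (Q6 j))[].
move=> tP; have tl j : (t j < l)%N by case: (tP j).
have /fin_all_exists[b gE] j : exists b : bool,
    tnth g j = (-1) ^+ b *: (e - tnth f (t j)).
  by case: (tP j).
have t_inj : injective t.
  move=> j k tjk; apply/eqP/idPn => jk.
  have := coord_tnth free_g k k.
  rewrite eqxx (_ : tnth g k = (-1) ^+ (b j + b k) *: tnth g j).
    rewrite linearZ_LR /= coord_tnth // eq_sym (negPf jk) mulr0.
    by move/esym/eqP; rewrite oner_eq0.
  rewrite [tnth g k]gE [tnth g j]gE tjk scalerA; congr (_ *: _).
  by case: (b j); case: (b k); ring.
case/andP: (ln) => l6 len.
have n0 : (0 < n)%N by apply: leq_trans len; apply: leq_trans l6.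
have lE : l = 6%N by case: (Qmin (Ordinal n0)) => _ /(_ (Q6 _))[].
(* An injective self-map of ['I_n] is onto, so [t] takes the value [n.-1], which is therefore below
   [l]. *)
have nl : l = n.
  apply/eqP; rewrite eqn_leq len -ltnS.
  have lt_max : (n.-1 < n)%N by rewrite prednK.
  have := tl (invF t_inj (Ordinal lt_max)); rewrite f_invF /= prednK //.
have n6 : n = 6%N by rewrite -nl.
(* Composing the weights with the inverse of [t] attaches index [j] to [e - f_j]; the signs cancel
   in the products of coordinates. *)
split=> //; have [] := @watson_coefficients R n mu (la \o (perm t_inj)^-1%g) n6.
  move=> i k; rewrite -moments (reindex_inj (@perm_inj _ (perm t_inj))) /=.
  apply: eq_bigr => j _; rewrite permK permE; congr (_ * _).
  rewrite gE !linearZ_LR !linearB /= !coord_third_sum // !coord_tnth // nl !ltn_ord.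
  by case: (b j); rewrite ?expr0 ?expr1 /=; ring.
move=> a aE; have laE j : la j = a by have [_] := aE (perm t_inj j); rewrite /= permK.
exists a, (perm t_inj); split=> [|i|j].
- by rewrite -(laE (Ordinal n0)) lt0r_neq0.
- by case: (aE i).
- by split; [exact: laE | rewrite permE gE proj_line_sign].
Qed.

(** * Normal form of the generator by signs and renumbering *)

Lemma perm_prefix n (A : {set 'I_n}) :
  exists s : 'S_n, forall i : 'I_n, (i < #|A|)%N = (s i \in A).
Proof.
(* Listing [A] first and its complement afterwards rearranges all the indices. *)
have /tuple_permP[s sE] : perm_eq (enum A ++ enum (~: A)) (ord_tuple n).
  rewrite val_ord_tuple; apply: uniq_perm; first 1 last.
  - exact: enum_uniq.
  - by move=> i; rewrite mem_cat !mem_enum !inE orbN.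
  rewrite cat_uniq !enum_uniq andbT /=; apply/hasPn => i.
  by rewrite !mem_enum inE.
exists s => i; have := congr1 (fun u : seq 'I_n => nth i u i) sE.
rewrite -[in RHS]tnth_nth tnth_mktuple tnth_ord_tuple nth_cat -cardE => <-.
case: ltnP => iA; first by rewrite -mem_enum mem_nth // -cardE.
apply/esym/negbTE; rewrite -in_setC -mem_enum mem_nth // -cardE cardsCs setCK card_ord.
by rewrite ltn_sub2r // (leq_ltn_trans iA).
Qed.

(** Only the class of the generator modulo [B] matters; this allows passing from an abstract
    generator to a [third_sum]. *)
Lemma add_cyclic_shift (V : zmodType) (B : V -> Prop) v w x :
  subgroup B -> B (v - w) -> add_cyclic B v x -> add_cyclic B w x.
Proof.
move=> sB Bvw [y [m [By ->]]]; exists (y + (v - w) *~ m), m; split.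
  by apply: subgroupD => //; apply: subgroupMz.
by rewrite mulrzBl addrA subrK.
Qed.

Section SignedRenumbering.

Variables (R : realType) (E : vectType R) (n : nat) (e : n.-tuple E).
Variables (eps : 'I_n -> bool) (s : 'S_n).

Let f := signed_renumbering e eps s.

Lemma tnth_signed_renumbering i : tnth f i = (-1) ^+ eps i *: tnth e (s i).
Proof. by rewrite tnth_mktuple. Qed.

Lemma signed_renumberingK i :
  tnth e i = (-1) ^+ eps ((s^-1)%g i) *: tnth f ((s^-1)%g i).
Proof. by rewrite tnth_signed_renumbering permKV scalerA -signr_addb addbb scale1r. Qed.

Lemma basis_signed_renumbering : basis_of fullv e -> basis_of fullv f.
Proof.
move=> be; have dimE := size_basis be; rewrite basisEdim size_tuple dimE leqnn andbT.
rewrite -(span_basis be); apply/span_subvP => x /tnthP[i ->].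
by rewrite signed_renumberingK memvZ // memv_span // mem_tnth.
Qed.

Lemma inIntSpan_signed_renumbering x : inIntSpan e x -> inIntSpan f x.
Proof.
apply: inIntSpan_min x; first exact: inIntSpan_subgroup.
move=> x /tnthP[i ->]; rewrite signed_renumberingK.
case: (eps _); rewrite ?scale1r ?expr1 ?scaleN1r; last first.
  by apply: mem_inIntSpan; rewrite mem_tnth.
by apply: (subgroupN (inIntSpan_subgroup f)); apply: mem_inIntSpan; rewrite mem_tnth.
Qed.

End SignedRenumbering.

(** Write the integral coordinates of [3 v] as [3 q_i + r_i] with [r_i] in -1, 0, 1. Modulo the
    span, [v] is a third of the sum of the [r_i e_i]; negate where [r_i = -1] and put the nonzero
    [r_i] first. *)
Lemma exists_third_sum (R : realType) (E : vectType R) n (e : n.-tuple E) v :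
    basis_of fullv e -> inIntSpan e (v *+ 3) ->
  exists (eps : 'I_n -> bool) (s : 'S_n) (l : nat), (l <= n)%N /\
    inIntSpan e (v - third_sum (signed_renumbering e eps s) l).
Proof.
move=> be /(coord_inIntSpan (basis_free be))[z vz].
have /fin_all_exists[q] i := centered_mod3 (z i).
move=> /fin_all_exists[r zE].
have [s sA] := perm_prefix [set i | r i != 0].
(* In [signed_renumbering], [eps i] is the sign of [e_(s i)], hence the test at [s i]. *)
exists (fun i => r (s i) == -1), s, #|[set i | r i != 0]|.
split; first by rewrite -[X in (_ <= X)%N]card_ord max_card.
have -> : third_sum (signed_renumbering e (fun i => r (s i) == -1) s) #|[set i | r i != 0]|
        = 3^-1 *: \sum_i (r i)%:~R *: tnth e i.
  rewrite /third_sum [in RHS](reindex_inj (@perm_inj _ s)) /= big_mkcond.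
  congr (_ *: _); apply: eq_bigr => i _; rewrite sA inE tnth_signed_renumbering.
  have [_ r1 r2] := zE (s i).
  have [->|[->|->]] : r (s i) = 0 \/ r (s i) = 1 \/ r (s i) = -1 by lia.
  - by rewrite eqxx scale0r.
  - by rewrite /= expr0.
  - by rewrite /= expr1.
exists [ffun i => q i].
rewrite {1}(coord_basis be (memvf v)) scaler_sumr -sumrB; apply: eq_bigr => i _.
rewrite ffunE -scaler_int -tnth_nth scalerA -scalerBl; congr (_ *: _).
have := vz i; have [-> _ _] := zE i.
rewrite linearMn /= -mulr_natr intrD intrM; lra.
Qed.

(** * Minimal vectors and the classification of the relation *)

Lemma minimal_vector_norm (R : realType) (E : vectType R) (dot : {dot E for idfun})
    (L : E -> Prop) x y :
  minimal_vector dot L x -> minimal_vector dot L y -> dot x x = dot y y.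
Proof.
by case=> Lx x0 minx [Ly y0 miny]; apply/le_anti; rewrite minx // miny.
Qed.

Lemma lattice_subgroup (R : realType) (E : vectType R) (L : E -> Prop) :
  lattice L -> subgroup L.
Proof.
case=> b [_ LE]; have [s0 sB] := inIntSpan_subgroup b.
by split=> [|x y]; rewrite !LE //; apply: sB.
Qed.

Theorem theorem5p1 (R : realType) (E : vectType R) (dot : {dot E for idfun})
    (n : nat) (dimE : \dim {:E} = n)
    (L : E -> Prop) (latL : lattice L)
    (e e' : n.-tuple E) (free_e : free e) (free_e' : free e')
    (lam lam' : 'I_n -> R)
    (lam_gt0 : forall i, 0 < lam i) (lam'_gt0 : forall i, 0 < lam' i)
    (rel : perfection_relation dot L lam e lam' e')
    (index3 : has_index (inIntSpan [tuple of e ++ e']) (inIntSpan e) 3) :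
  let Lambda0 := inIntSpan e in
  let Lambda := inIntSpan [tuple of e ++ e'] in
  let normalized (f : n.-tuple E) (l : nat) :=
    (exists (eps : 'I_n -> bool) (s : 'S_n), f = signed_renumbering e eps s)
    /\ (l <= n)%N
    /\ (forall x, Lambda x <-> add_cyclic Lambda0 (third_sum f l) x) in
  (exists f l, normalized f l)
  /\ (forall f l, normalized f l ->
        l = n /\ n = 6%N
        /\ proportional_relations dot
             lam e lam' e'
             (fun=> 1) f (fun=> 1) [tuple third_sum f l - tnth f i | i < n]).
Proof.
move=> Lambda0 Lambda normalized.
have be : basis_of fullv e by rewrite basisEfree free_e subvf dimE size_tuple leqnn.
have sL0 : subgroup Lambda0 by apply: inIntSpan_subgroup.
have sL : subgroup Lambda by apply: inIntSpan_subgroup.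
have L0L x : Lambda0 x -> Lambda x.
  apply: inIntSpan_min x => // x xe; apply: mem_inIntSpan.
  by rewrite mem_cat xe.
have [min_e min_e' proj_neq relE] := rel.
have LambdaL x : Lambda x -> L x.
  apply: inIntSpan_min x; first exact: lattice_subgroup.
  move=> x; rewrite mem_cat => /orP[] /tnthP[i ->]; first by case: (min_e i).
  by case: (min_e' i).
split.
  have [v [Lv nL0v L03v LE]] := index3_generator sL sL0 index3 L0L.
  have [eps [s [l [ln vl]]]] := exists_third_sum be L03v.
  exists (signed_renumbering e eps s), l; split; first by exists eps, s.
  split=> // x; split=> [/LE|x_third]; first exact: add_cyclic_shift.
  by apply/LE; apply: add_cyclic_shift x_third => //; rewrite -opprB; apply: subgroupN.
move=> f l [[eps [s fE]] [ln LE]].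
have bf : basis_of fullv f by rewrite fE; apply: basis_signed_renumbering.
have ff := basis_free bf.
(* For [l = 0] the adjoined vector is zero, so [Lambda] would be contained in [Lambda0]. *)
have l0 : (0 < l)%N.
  rewrite lt0n; apply/eqP => l0; apply: (index3_not_sub sL sL0 index3) => x /LE.
  rewrite l0 /third_sum big1 => [|i]; last by rewrite ltn0.
  by case=> y [m [L0y ->]]; rewrite scaler0 mul0rz addr0.
pose i0 := Ordinal (leq_trans l0 ln); pose N := dot (tnth e i0) (tnth e i0).
have tfE i : tnth f i = (-1) ^+ eps i *: tnth e (s i).
  by rewrite fE tnth_signed_renumbering.
have norm_f i : dot (tnth f i) (tnth f i) = N.
  by rewrite tfE hnorm_sign; apply: minimal_vector_norm.
have norm_e' i : dot (tnth e' i) (tnth e' i) = N by apply: minimal_vector_norm.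
have proj_f i : proj_line dot (tnth f i) = proj_line dot (tnth e (s i)).
  by rewrite tfE proj_line_sign.
have N0 : 0 < N by rewrite neq0_dnorm_gt0 //; case: (min_e i0).
have Lambda_third : Lambda (third_sum f l).
  by apply/LE; exists 0, 1; rewrite add0r mulr1z; split=> //; case: sL0.
(* The vectors [e - f_i] with [i < l] are nonzero in [L], so their norms are at least [N]; Watson's
   identity then gives [0 <= (l - 6) N(e)]. *)
have l6 : (6 <= l)%N.
  have third0 : third_sum f l != 0.
    apply/eqP => /(congr1 (coord f i0)); rewrite coord_third_sum // linear0 /=.
    by rewrite l0 mulr1 => /eqP; rewrite invr_eq0 pnatr_eq0.
  have := watson_identity ln norm_f.
  have : 0 <= \sum_(i < n | (i < l)%N)
      (dot (third_sum f l - tnth f i) (third_sum f l - tnth f i) - N).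
    apply: sumr_ge0 => i il; rewrite subr_ge0.
    have [_ _] := min_e i0; apply.
      apply: (proj2 (lattice_subgroup latL)); first exact: LambdaL.
      rewrite -[tnth f i]add0r tfE.
      case: (min_e (s i)) => Le _ _.
      case: (eps i); rewrite ?scale1r ?expr1 ?scaleN1r add0r //.
      exact: subgroupN (lattice_subgroup latL) Le.
    (* The [i]-th coordinate of the difference is [1/3 - 1], which is nonzero. *)
    apply/eqP => /(congr1 (coord f i)); rewrite linearB /= coord_third_sum //.
    by rewrite coord_tnth // il eqxx linear0 /= mulr1; lra.
  move=> ge0 eq; move: ge0; rewrite eq pmulr_lge0 ?neq0_dnorm_gt0 //.
  by rewrite subr_ge0 ler_nat.
have relf : \sum_i lam (s i) *: proj_line dot (tnth f i)
          = \sum_j lam' j *: proj_line dot (tnth e' j).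
  rewrite -relE [in RHS](reindex_inj (@perm_inj _ s)).
  by apply: eq_bigr => i _; rewrite proj_f.
have e'L j : add_cyclic (inIntSpan f) (third_sum f l) (tnth e' j).
  have /LE[y [m [L0y ->]]] : Lambda (tnth e' j).
    by apply: mem_inIntSpan; rewrite mem_cat mem_tnth orbT.
  by exists y, m; split=> //; rewrite fE; apply: inIntSpan_signed_renumbering.
have proj_neq' i j : proj_line dot (tnth f i) != proj_line dot (tnth e' j).
  by rewrite proj_f.
have [] := watson_relation bf free_e' N0 norm_f norm_e' lam'_gt0 e'L proj_neq' relf.
  by rewrite l6.
move=> -> n6 [a [t [a0 lamE lam'E]]]; split=> //; split=> //.
(* The inverse of [s] appears because [f_i] spans the line of [e_(s i)]. *)
exists a, (s^-1)%g, t; split=> // [i|j].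
  by rewrite mulr1 -[in lam i](permKV s i) lamE proj_f permKV.
by rewrite mulr1 tnth_mktuple.
Qed.
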